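(* Let $T$ be an integral domain which is not a field, $M$ a maximal ideal of $T$, $K=T/M$, $\phi:T\to K$ the canonical projection, $D$ a subring of $K$, and $R=\phi^{-1}(D)$; assume that $R\subsetneq T$. Then $R$ is $t$-linked under $T$ if and only if $D$ is a field and $M$ is a $t$-ideal of $T$.
   Context: $R=\phi^{-1}(D)$ is the pullback of $D\hookrightarrow K$ along $\phi$; $R$ and $T$ have a common quotient field $L$. For an ideal $I$ of $R$, $I^{-1}=(R:I)=\{x\in L: xI\subseteq R\}$ and $(T:IT)=\{x\in L: xIT\subseteq T\}$. $R$ is $t$-linked under $T$ if, for each finitely generated ideal $I$ of $R$, $(T:IT)=T$ implies $I^{-1}=R$. For a nonzero ideal $J$ of $T$, $J_v=(T:(T:J))$ and $J_t=\bigcup A_v$, where $A$ ranges over the nonzero finitely generated ideals of $T$ contained in $J$; $J$ is a $t$-ideal of $T$ if $J=J_t$. *)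

(* Defs.v *)
From HB Require Import structures.
From mathcomp Require Import all_boot all_algebra.
From mathcomp Require Import boolp classical_sets.

Set Implicit Arguments.
Unset Strict Implicit.
Unset Printing Implicit Defensive.

Import GRing.Theory.
Local Open Scope ring_scope.
Local Open Scope quotient_scope.
Local Open Scope classical_set_scope.

(* Subrings of a field L, and their (possibly fractional) ideals, are all
   subsets of L. *)
Section InField.
Variable L : fieldType.
Implicit Types (A B I J : set L).

(* The finite sums of products a * b, including the empty sum 0. *)
Definition set_prod A B : set L :=
  [set x | exists n (a b : 'I_n -> L),
     (forall i, A (a i) /\ B (b i)) /\ x = \sum_(i < n) a i * b i].

Definition is_ideal A I : Prop :=
  [/\ I `<=` A, I 0 & forall a u v, A a -> I u -> I v -> I (a * u + v)].

Definition fg_ideal A I : Prop :=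
  is_ideal A I /\ exists s : seq L, I = set_prod A [set` s].

Definition colon A J : set L := [set x | [set x * y | y in J] `<=` A].

(* A is t-linked under B *)
Definition t_linked_under A B : Prop :=
  forall I, fg_ideal A I -> colon B (set_prod I B) = B -> colon A I = A.

Definition v_closure A J : set L := colon A (colon A J).

Definition t_closure A J : set L :=
  [set x | exists I, [/\ fg_ideal A I, I <> [set 0], I `<=` J
                       & v_closure A I x]].

Definition t_ideal A J : Prop :=
  [/\ is_ideal A J, J <> [set 0] & J = t_closure A J].

End InField.

(* Any J : idealr T is proper, i.e. does not contain 1. *)
Definition maximal_ideal (T : comNzRingType) (M : idealr T) : Prop :=
  forall J : idealr T, {subset M <= J} -> J =i M.

Definition subring_is_field (K : comNzRingType) (D : subringClosed K) : Prop :=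
  forall x, x \in D -> x != 0 -> exists2 y, y \in D & x * y = 1.

Definition pullback (T : comNzRingType) (M : idealr T)
    (D : subringClosed {ideal_quot M}) : set T :=
  [set x | \pi_{ideal_quot M} x \in D].

(* The image in the quotient field {fraction T} of a subset of T. *)
Definition in_frac (T : idomainType) (A : set T) : set {fraction T} :=
  [set FracField.tofrac x | x in A].

(* Main.v *)
(** If [x] in [R] is invertible modulo [M], say [m = 1 - x y] with [m] in [M]
    and [y] in [T], then the ideal [I = (x, m)] of [R] satisfies [IT = T], and
    [y] lies in [(R : I)]; so [t]-linkedness forces [y] in [R], and [D] is a
    field. If [M] were not a [t]-ideal, there would be finitely many elements
    of [M] whose [v]-closure is not contained in [M]; adding one more element
    of [M], the [v]-closure becomes [T], and [t]-linkedness applied to the ideal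
    [I] of [R] generated by these elements gives [(R : I) = R], although
    [IT] is contained in [M], hence in [R], so that [T] is contained in
    [(R : I)].
    Conversely, if [D] is a field and [M] is a [t]-ideal, then [(T : IT) = T]
    prevents [I] from being contained in [M], so [I] contains some [x] with an
    inverse [y] in [R] modulo [M]; for [z] in [(R : I)], which is contained in
    [T], both terms of [z = y (z x) + z (1 - x y)] lie in [R]. *)
Require Import Defs.
From HB Require Import structures.
From mathcomp Require Import all_boot all_algebra.
From mathcomp Require Import boolp classical_sets.

Local Open Scope ring_scope.
Local Open Scope classical_set_scope.

Set Implicit Arguments.

Import GRing.Theory.

(** * Ideals, products and colons of subsets of a field *)

Section SubsetsOfAField.
Variable L : fieldType.
Implicit Types (A B I J M : set L) (s : seq L).

(** Being an ideal of itself gives 0 and closure under [a * u + v]; with 1 and -1 this yields sums,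
    products and opposites. *)
Definition is_subring A : Prop := [/\ is_ideal A A, A 1 & A (-1)].

Lemma is_idealD A I : A 1 -> is_ideal A I ->
  forall u v, I u -> I v -> I (u + v).
Proof. by move=> A1 [_ _ AI] u v Iu Iv; rewrite -[u]mul1r; exact: AI. Qed.

Lemma is_idealM A I : is_ideal A I -> forall a u, A a -> I u -> I (a * u).
Proof. by move=> [_ I0 AI] a u Aa Iu; rewrite -[a * u]addr0; exact: AI. Qed.

Lemma set_prod_mul A B a b : A a -> B b -> set_prod A B (a * b).
Proof.
move=> Aa Bb; exists 1%N, (fun=> a), (fun=> b); split=> //.
by rewrite big_ord1.
Qed.

Lemma set_prod_sub A B J : J 0 -> (forall u v, J u -> J v -> J (u + v)) ->
  (forall a b, A a -> B b -> J (a * b)) -> set_prod A B `<=` J.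
Proof.
move=> J0 JD JM x [n [a [b [ab ->]]]].
by apply: big_ind => // i _; have [Aa Bb] := ab i; exact: JM.
Qed.

Lemma set_prod0 A B : set_prod A B 0.
Proof.
by exists 0%N, (fun=> 0), (fun=> 0); rewrite big_ord0; split=> // -[].
Qed.

Lemma set_prodD A B x y :
  set_prod A B x -> set_prod A B y -> set_prod A B (x + y).
Proof.
move=> [n [a [b [ab ->]]]] [m [c [d [cd ->]]]].
pose glue (f : 'I_n -> L) (g : 'I_m -> L) k :=
  match split k with inl i => f i | inr j => g j end.
exists (n + m)%N, (glue a c), (glue b d); split.
  by move=> k; rewrite /glue; case: (split k).
rewrite big_split_ord /=; congr (_ + _); apply: eq_bigr => i _.
  by rewrite /glue (unsplitK (inl i)).
by rewrite /glue (unsplitK (inr i)).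
Qed.

Lemma set_prodMl A B a x : (forall u, A u -> A (a * u)) ->
  set_prod A B x -> set_prod A B (a * x).
Proof.
move=> aA [n [b [c [bc ->]]]]; exists n, (fun i => a * b i), c; split.
  by move=> i; have [Ab Bc] := bc i; split=> //; exact: aA.
by rewrite mulr_sumr; apply: eq_bigr => i _; rewrite mulrA.
Qed.

Lemma set_prod_gen A B b : A 1 -> B b -> set_prod A B b.
Proof. by rewrite -{2}[b]mul1r; exact: set_prod_mul. Qed.

Lemma set_prod_sub_ideal A B I : A 1 -> is_ideal A I -> B `<=` I ->
  set_prod A B `<=` I.
Proof.
move=> A1 AI BI; apply: set_prod_sub; [by case: AI | exact: is_idealD AI |].
by move=> a b Aa /BI; exact: is_idealM AI _ _ Aa.
Qed.

Lemma fg_ideal_set_prod A s : is_subring A -> [set` s] `<=` A ->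
  fg_ideal A (set_prod A [set` s]).
Proof.
move=> [AA A1 _] sA; split; last by exists s.
split; [exact: set_prod_sub_ideal | exact: set_prod0 |].
move=> a u v Aa Iu Iv; apply: set_prodD => //.
by apply: set_prodMl => // b; exact: is_idealM AA _ _ Aa.
Qed.

Lemma colonP A J x : colon A J x <-> forall y, J y -> A (x * y).
Proof.
split=> [xJ y Jy|xJ _ [y Jy <-]]; last exact: xJ.
by apply: xJ; exists y.
Qed.

Lemma colon_set_prod A I J x : is_subring A ->
  colon A (set_prod I J) x <-> forall i j, I i -> J j -> A (x * (i * j)).
Proof.
move=> [AA A1 _]; rewrite colonP; split=> [xIJ i j Ii Jj|xIJ y].
  by apply: xIJ; exact: set_prod_mul.
apply: (set_prod_sub [set y | A (x * y)]) => //=.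
  by rewrite mulr0; case: AA.
by move=> u v Au Av; rewrite mulrDr; exact: is_idealD AA _ _ Au Av.
Qed.

Lemma ideal_sub_colon A I : is_ideal A I -> A `<=` colon A I.
Proof.
move=> AI a Aa; apply/colonP => i Ii.
by case: (AI) => IA _ _; apply/IA; exact: is_idealM AI _ _ Aa Ii.
Qed.

(** Extension from [A] to [B] keeps the generators, so the extended ideal is finitely generated over
    [B]. *)
Lemma set_prod_extension A B s : is_subring B -> A `<=` B -> A 1 ->
  set_prod (set_prod A [set` s]) B = set_prod B [set` s].
Proof.
move=> [BB B1 _] AB A1; apply/seteqP; split; apply: set_prod_sub;
  try by [exact: set_prod0 | exact: set_prodD].
  move=> i b Ii Bb; rewrite mulrC; apply: set_prodMl.
    by move=> u; exact: is_idealM BB _ _ Bb.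
  case: Ii => n [a [c [ac ->]]]; exists n, a, c; split=> // k.
  by have [/AB] := ac k.
by move=> b c Bb sc; rewrite mulrC; apply: set_prod_mul => //;
  exact: set_prod_gen.
Qed.

(** The ideal generated by [x] alone would be zero for [x = 0], which [t_closure] excludes; hence a
    second generator [w], a nonzero element of [M]. *)
Lemma t_closure_ge B M : is_subring B -> is_ideal B M -> M <> [set 0] ->
  M `<=` t_closure B M.
Proof.
move=> Bring BM Mn0 x Mx.
have [MB M0 _] := BM; have [BB B1 _] := Bring.
have [w [Mw w0]] : exists w, M w /\ w <> 0.
  apply: contrapT => nw; apply: Mn0; apply/seteqP; split=> [y My|_ ->//].
  by apply: contrapT => y0; apply: nw; exists y.
have sM : [set` [:: x; w]] `<=` M.
  by move=> y /=; rewrite !inE => /orP[] /eqP ->.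
have gen y : y \in [:: x; w] -> set_prod B [set` [:: x; w]] y.
  by move=> ys; exact: set_prod_gen.
exists (set_prod B [set` [:: x; w]]); split.
- by apply: fg_ideal_set_prod => //; exact: subset_trans sM MB.
- move=> I0; apply: w0; have := gen w; rewrite I0 /= => -> //.
  by rewrite !inE eqxx orbT.
- exact: set_prod_sub_ideal.
- apply/colonP => z /colonP Bz; rewrite mulrC; apply/Bz/gen.
  by rewrite !inE eqxx.
Qed.

(** * Both implications, for subrings [A] and [B] of a field that share the ideal [M] *)

Section Linked.
Variables A B M : set L.
Hypotheses (A_ring : is_subring A) (B_ring : is_subring B).
Hypotheses (M_ideal : is_ideal B M) (M_neq0 : M <> [set 0]) (M1 : ~ M 1).
Hypotheses (MA : M `<=` A) (AB : A `<=` B) (AB_neq : A <> B).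
(** Maximality in elementwise form: [B] modulo [M] is a field. *)
Hypothesis M_max :
  forall x, B x -> ~ M x -> exists2 y, B y & M (1 - x * y).

Lemma linked_unit_mod : t_linked_under A B ->
  forall x, A x -> ~ M x -> exists2 y, A y & M (1 - x * y).
Proof.
move=> linked x Ax nMx.
have [AA A1 _] := A_ring; have [BB B1 _] := B_ring.
have [y By Mm] := M_max (AB Ax) nMx; exists y => //.
set m := 1 - x * y in Mm.
have sA : [set` [:: x; m]] `<=` A.
  by move=> u /=; rewrite !inE => /orP[] /eqP -> //; exact: MA.
have fgI := fg_ideal_set_prod _ A_ring sA.
have gen u : u \in [:: x; m] -> set_prod A [set` [:: x; m]] u.
  by move=> us; exact: set_prod_gen.
have IA : set_prod A [set` [:: x; m]] `<=` A by case: fgI => -[].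
rewrite -(linked _ fgI).
  apply/colonP => u [n [a [b [ab ->]]]].
  rewrite mulr_sumr; apply: big_ind => [|u1 u2|i _]; first by case: AA.
    exact: is_idealD AA u1 u2.
  have [Aa /=] := ab i; rewrite !inE mulrCA => bs.
  apply: (is_idealM AA) => //; case/orP: bs => /eqP ->.
    (* Although [y] is only known to be in [B], [y * x] is [1 - m] with [m] in [M], hence in [A]. *)
    have -> : y * x = -1 * m + 1 by rewrite /m mulN1r opprB subrK mulrC.
    apply: (is_idealD _ AA) => //.
    by apply: (is_idealM AA); [case: A_ring | exact: MA].
  by apply: MA; exact: is_idealM M_ideal _ _ By Mm.
apply/seteqP; split=> z.
  move/colon_set_prod => /(_ B_ring) Bz.
  (* This writes [z] as [z] times an element of the extended ideal, which contains
     [x * y + m = 1]. *)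
  have -> : z = z * (x * y) + z * (m * 1).
    by rewrite mulr1 /m -mulrDr addrC subrK mulr1.
  by apply: (is_idealD _ BB) => //; apply: Bz => //; apply: gen;
    rewrite !inE eqxx ?orbT.
move=> Bz; apply/colon_set_prod => // i j /IA/AB Bi Bj.
by do 2!apply: (is_idealM BB) => //.
Qed.

Lemma linked_t_ideal : t_linked_under A B -> t_ideal B M.
Proof.
move=> linked; split=> //.
have [AA A1 _] := A_ring; have [BB B1 BN1] := B_ring; have [MB M0 _] := M_ideal.
apply/seteqP; split=> [|x]; first exact: t_closure_ge.
move=> [I [[BI [s Is]] _ IM /colonP vx]].
(* Since 1 lies in [colon B I], the v-closure of [I] is contained in [B]. *)
have Bx : B x by rewrite -[x]mulr1; apply: vx; exact: ideal_sub_colon.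
apply: contrapT => nMx; have [y By Mm] := M_max Bx nMx.
set m := 1 - x * y in Mm.
(* With [x] in the v-closure of [I], the extra generator [m] brings [1 = x * y + m] into the
   v-closure of the enlarged ideal. *)
pose s' := m :: s.
have s'M : [set` s'] `<=` M.
  move=> u /=; rewrite inE => /orP[/eqP -> //|us].
  by apply: IM; rewrite Is; exact: set_prod_gen.
have fgJ := fg_ideal_set_prod _ A_ring (subset_trans s'M MA).
have JM : set_prod A [set` s'] `<=` M.
  apply: set_prod_sub => //; first exact: is_idealD M_ideal.
  by move=> a b /AB Ba /s'M; exact: is_idealM M_ideal _ _ Ba.
apply: AB_neq; apply/seteqP; split=> // b Bb; rewrite -(linked _ fgJ).
  by apply/colonP => j /JM Mj; apply: MA; exact: is_idealM M_ideal _ _ Bb Mj.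
rewrite set_prod_extension //; apply/seteqP; split=> z.
  move/colon_set_prod => /(_ B_ring) Bz.
  (* As [z] multiplies the generators [s] of [I] into [B], it lies in [colon B I], so [x * z] is in
     [B]. *)
  have -> : z = y * (x * z) + z * (1 * m).
    by rewrite mul1r /m mulrA [y * x]mulrC [z * _]mulrC -mulrDl addrC subrK mul1r.
  apply: (is_idealD _ BB) => //; last first.
    by apply: Bz => //=; rewrite inE eqxx.
  apply: (is_idealM BB) => //; apply: vx.
  rewrite Is; apply/colon_set_prod => // a c Ba sc; apply: Bz => //=.
  by rewrite inE [_ \in _]sc orbT.
move=> Bz; apply/colon_set_prod => // c d Bc /s'M/MB Bd.
by do 2!apply: (is_idealM BB) => //.
Qed.

Lemma t_ideal_linked :
  (forall x, A x -> ~ M x -> exists2 y, A y & M (1 - x * y)) ->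
  t_ideal B M -> t_linked_under A B.
Proof.
move=> unitA [_ _ Mt] I [AI [s Is]] IB.
have [AA A1 _] := A_ring; have [BB B1 BN1] := B_ring; have [MB M0 _] := M_ideal.
have [IA _ _] := AI.
have sI : [set` s] `<=` I by move=> c sc; rewrite Is; exact: set_prod_gen.
(* Otherwise the extension of [I] lies in [M] and its colon is [B], so 1 is in its v-closure, hence
   in the t-closure [M]. *)
have [x [Ix nMx]] : exists x, I x /\ ~ M x.
  apply: contrapT => nIM.
  have IM : I `<=` M.
    by move=> x Ix; apply: contrapT => nMx; apply: nIM; exists x.
  have IBs : set_prod I B = set_prod B [set` s].
    by rewrite Is set_prod_extension.
  apply: M1; rewrite Mt; exists (set_prod I B); split.
  - rewrite IBs; apply: fg_ideal_set_prod => //.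
    exact: subset_trans sI (subset_trans IM MB).
  (* If the extension of [I] were zero, its colon [B] would be the whole field, and any nonzero [w]
     in [M] would force 1 into [M]. *)
  - move=> I0; apply: M_neq0; apply/seteqP; split=> [w Mw /=|_ ->//].
    apply: contrapT => w0; apply: M1.
    rewrite -(mulVf (introN eqP w0)); apply: (is_idealM M_ideal) => //.
    by rewrite -IB I0; apply/colonP => _ ->; rewrite mulr0; case: BB.
  - rewrite IBs; apply: set_prod_sub_ideal => //.
    exact: subset_trans sI IM.
  - by apply/colonP => z; rewrite IB mul1r.
have [y Ay Mm] := unitA _ (IA _ Ix) nMx.
apply/seteqP; split; last exact: ideal_sub_colon.
move=> z /colonP Az.
have Bz : B z.
  rewrite -IB; apply/colon_set_prod => // i j Ii Bj.
  by rewrite mulrA mulrC; apply: is_idealM BB _ _ Bj (AB (Az _ Ii)).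
have -> : z = y * (z * x) + z * (1 - x * y).
  by rewrite mulrCA -mulrDr [y * x]mulrC addrC subrK mulr1.
apply: (is_idealD _ AA) => //; first exact: is_idealM AA _ _ Ay (Az _ Ix).
exact/MA/(is_idealM M_ideal).
Qed.

End Linked.
End SubsetsOfAField.

Arguments is_subring {L} A.

(** * Inverses modulo a maximal ideal, and the condition that [D] is a field *)

Section Quotient.
Variables (T : comNzRingType) (M : idealr T).

Lemma pi_ideal_quot_eq0 x : (\pi_{ideal_quot M}%qT x == 0) = (x \in M).
Proof. by rewrite -[x in RHS]subr0 Quotient.idealrBE rmorph0. Qed.

Section Adjoin.
Variable x : T.

(** The ideal [M + xT]. It is proper, as [idealr] demands, exactly when [x] has no inverse modulo
    [M]. *)
Definition adjoin : T -> bool := fun a => `[< exists t, a - x * t \in M >].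

Hypothesis x_nonunit : forall t, 1 - x * t \notin M.

Fact adjoin_closed : idealr_closed adjoin.
Proof.
split; rewrite ?unfold_in.
- by apply/asboolP; exists 0; rewrite mulr0 subr0 rpred0.
- by apply/asboolPn => -[t]; apply/negP/x_nonunit.
- move=> a u v; rewrite !unfold_in => /asboolP[t Mt] /asboolP[t' Mt'].
  apply/asboolP; exists (a * t + t').
  have -> : a * u + v - x * (a * t + t') = a * (u - x * t) + (v - x * t').
    by rewrite mulrBr mulrDr opprD addrACA [x * (a * t)]mulrCA.
  by rewrite rpredD // idealMr.
Qed.

HB.instance Definition _ := isIdealr.Build T adjoin adjoin_closed.

Definition adjoin_idealr : idealr T := adjoin.

End Adjoin.

(** Without such a [y], [M + xT] would be a proper ideal containing [M], hence equal to [M], and yet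
    contain [x]. *)
Lemma maximal_ideal_unit : maximal_ideal M ->
  forall x, x \notin M -> exists y, 1 - x * y \in M.
Proof.
move=> Mmax x nMx; apply: contrapT => nex.
have xnu t : 1 - x * t \notin M by apply/negP => Mt; apply: nex; exists t.
have /Mmax/(_ x) : {subset M <= adjoin_idealr _ xnu}.
  by move=> a Ma; apply/asboolP; exists 0; rewrite mulr0 subr0.
rewrite (negbTE nMx); suff -> : x \in adjoin_idealr _ xnu by [].
by apply/asboolP; exists 1; rewrite mulr1 subrr rpred0.
Qed.

(** Lifting classes to representatives turns the condition on [D] into the elementwise form used for
    [A] and [M]. *)
Lemma subring_is_field_pullback (D : subringClosed {ideal_quot M}) :
  subring_is_field D <->
  forall x, pullback D x -> x \notin M ->
    exists2 y, pullback D y & 1 - x * y \in M.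
Proof.
split=> [Dfield x Dx nMx|unitD d].
  have [|d] := Dfield _ Dx; first by rewrite pi_ideal_quot_eq0.
  rewrite -[d]reprK => Dy xy1; exists (repr d) => //.
  by rewrite -pi_ideal_quot_eq0 rmorphB rmorphM /= xy1 rmorph1 subrr.
rewrite -[d]reprK => Dx; rewrite pi_ideal_quot_eq0 => nMx.
have [y Dy] := unitD _ Dx nMx.
rewrite -pi_ideal_quot_eq0 rmorphB rmorphM rmorph1 subr_eq0 => /eqP xy1.
by exists (\pi_{ideal_quot M}%qT y).
Qed.

End Quotient.

(** * Transfer along the embedding of [T] in its quotient field *)

Section Fractions.
Variable T : idomainType.
Implicit Types A B J : set T.

Lemma in_frac_tofrac A x : in_frac A (FracField.tofrac x) <-> A x.
Proof.
split=> [[y Ay /eqP]|Ax]; last by exists x.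
by rewrite tofrac_eq => /eqP <-.
Qed.

Lemma in_frac_sub A B : A `<=` B -> in_frac A `<=` in_frac B.
Proof. by move=> AB _ [x Ax <-]; exists x => //; exact: AB. Qed.

Lemma in_frac_ideal A J : J `<=` A -> J 0 ->
  (forall a u v, A a -> J u -> J v -> J (a * u + v)) ->
  is_ideal (in_frac A) (in_frac J).
Proof.
move=> JA J0 JD; split; first exact: in_frac_sub.
  by rewrite -tofrac0; exact/in_frac_tofrac.
move=> _ _ _ [a Aa <-] [u Ju <-] [v Jv <-].
by rewrite -tofracM -tofracD; apply/in_frac_tofrac/JD.
Qed.

Lemma in_frac_subring A : A 0 -> A 1 -> A (-1) ->
  (forall a u v, A a -> A u -> A v -> A (a * u + v)) ->
  is_subring (in_frac A).
Proof.
move=> A0 A1 AN1 AD; split; first exact: in_frac_ideal.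
  by rewrite -tofrac1; exact/in_frac_tofrac.
by rewrite -tofrac1 -tofracN; exact/in_frac_tofrac.
Qed.

End Fractions.

Theorem theorem5p6 (T : idomainType) (M : idealr T)
    (D : subringClosed {ideal_quot M})
    (T_not_field : ~ GRing.field_axiom T)
    (M_max : maximal_ideal M)
    (R_proper : pullback D `<` [set: T]) :
  t_linked_under (in_frac (pullback D)) (in_frac [set: T]) <->
  subring_is_field D /\ t_ideal (in_frac [set: T]) (in_frac [set x | x \in M]).
Proof.
set A := in_frac _; set B := in_frac _; set M' := in_frac _.
have A_ring : is_subring A.
  apply: in_frac_subring; rewrite /pullback /= ?rmorphN ?rmorph0 ?rmorph1.
  - exact: rpred0.
  - exact: rpred1.
  - exact: rpredN1.
  - by move=> a u v Da Du Dv; rewrite rmorphD rmorphM rpredD // rpredM.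
have B_ring : is_subring B by exact: in_frac_subring.
have M_ideal : is_ideal B M'.
  apply: in_frac_ideal => //=; first exact: rpred0.
  by move=> a u v _ Mu Mv; rewrite rpredD // idealMr.
have M1 : ~ M' 1 by rewrite -tofrac1 => /in_frac_tofrac /=; rewrite idealr1.
have M_neq0 : M' <> [set 0].
  (* If [M] were zero, an inverse modulo [M] would be a true inverse, and [T] would be a field. *)
  move=> M0; apply: T_not_field => x x0.
  have in0 z : z \in M -> z = 0.
    move=> Mz; apply/eqP; rewrite -tofrac_eq0; apply/eqP.
    suff : M' (FracField.tofrac z) by rewrite M0.
    exact/in_frac_tofrac.
  have nMx : x \notin M by apply: contra x0 => /in0 ->.
  have [y /in0/eqP] := maximal_ideal_unit M_max _ nMx.
  rewrite subr_eq0 => /eqP xy1.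
  by apply/unitrP; exists y; rewrite mulrC -xy1.
have MA : M' `<=` A.
  apply: in_frac_sub => x /=; rewrite /pullback /= -pi_ideal_quot_eq0.
  by move=> /eqP ->; exact: rpred0.
have AB : A `<=` B by exact: in_frac_sub.
have AB_neq : A <> B.
  move=> eqAB; case: R_proper => _; apply => x _.
  by apply/in_frac_tofrac; rewrite -/A eqAB; exact/in_frac_tofrac.
(* Stated for any [C], since it serves both for the pullback of [D] and for all of [T]. *)
have unit_frac C : (forall x, in_frac C x -> ~ M' x ->
      exists2 y, in_frac C y & M' (1 - x * y)) <->
    (forall x, C x -> x \notin M -> exists2 y, C y & 1 - x * y \in M).
  split=> unitC.
    move=> x Cx nMx; have [||_ [y Cy <-]] := unitC (FracField.tofrac x).
    - exact/in_frac_tofrac.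
    - by move=> /in_frac_tofrac; exact/negP.
    - by rewrite -tofracM -tofrac1 -tofracB => /in_frac_tofrac; exists y.
  move=> _ [x Cx <-] nMx; have [|y Cy My] := unitC x Cx.
    by apply/negP => Mx; apply/nMx/in_frac_tofrac.
  exists (FracField.tofrac y); first exact/in_frac_tofrac.
  by rewrite -tofracM -tofrac1 -tofracB; exact/in_frac_tofrac.
have B_max x : B x -> ~ M' x -> exists2 y, B y & M' (1 - x * y).
  move: x; apply/unit_frac => x _ nMx.
  by have [y] := maximal_ideal_unit M_max _ nMx; exists y.
rewrite subring_is_field_pullback; split=> [linked|[/unit_frac unitA Mt]].
  split; last exact: linked_t_ideal linked.
  by apply/unit_frac; exact: linked_unit_mod linked.
exact: t_ideal_linked Mt.
Qed.
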